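(* For every full-dimensional convex polyhedron $P\subset\mathbb R^3$, \[ L_{\mathrm{sq}}(P)=\ker\ell . \] Equivalently, the boundaries of the square cells of $X(P)$ generate precisely the integral cycles of even total edge parity in the antipodal graph $G_A(P)$.
   Context: A convex polyhedron $P\subset\mathbb R^3$ means a compact full-dimensional convex polytope. Two points of $P$ are antipodal if there are two parallel supporting planes of $P$, one through each point, that contain $P$ between them. The antipodal graph $G_A(P)$ has as vertices the vertices of $P$, with an edge $vw$ whenever $v,w$ are distinct antipodal vertices. The antipodal square complex $X(P)$ is the two-dimensional finite CW complex obtained from $G_A(P)$ by attaching one square 2-cell for every unordered pair $\{e,f\}$ of distinct edges of $P$ whose midpoints are antipodal: if $e=vv'$ and $f=ww'$, the square is attached along the four-cycle $v-w-v'-w'-v$ (such $e,f$ are disjoint, so the four vertices are distinct, and the four vertex pairs used are antipodal). Let $\mathcal S(P)$ be the set of square cells, with arbitrary orientations. $Z_1(G_A(P);\mathbb Z)=\ker(\partial_1:C_1(G_A(P);\mathbb Z)\to C_0(G_A(P);\mathbb Z))$ is the integral cycle lattice (edges oriented arbitrarily). $L_{\mathrm{sq}}(P)=\langle\partial s:s\in\mathcal S(P)\rangle_{\mathbb Z}\subseteq Z_1(G_A(P);\mathbb Z)$ is the subgroup generated by the cellular boundaries of the square cells. The parity map $\ell:Z_1(G_A(P);\mathbb Z)\to\mathbb Z/2$ is $\ell\left(\sum_e n_e e\right)=\sum_e n_e \bmod 2$. *)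

(* Defs.v *)
From mathcomp Require Import all_boot all_order all_algebra.
From mathcomp Require Import finmap.
From mathcomp Require Import all_classical all_reals all_analysis.

Set Implicit Arguments.
Unset Strict Implicit.
Unset Printing Implicit Defensive.

Import Order.TTheory GRing.Theory Num.Theory.
Import numFieldNormedType.Exports.

Local Open Scope classical_set_scope.
Local Open Scope ring_scope.

Section ConvexGeometry.
Variable R : realType.
Implicit Types (A F P : set 'rV[R]_3) (u v w x y z : 'rV[R]_3) (a b : R).

Definition dot u x : R := \sum_(i < 3) u 0 i * x 0 i.

Definition plane u a : set 'rV[R]_3 := [set x | dot u x = a].

Definition convex_hull A : set 'rV[R]_3 := smallest (@convex_set R 'rV[R]_3) A.

(* Compactness is automatic for the convex hull of a finite set. *)
Definition convex_polyhedron P : Prop :=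
  (exists2 A, finite_set A & P = convex_hull A) /\ P° !=set0.

Definition face P F : Prop :=
  exists u a, [/\ u != 0, forall x, P x -> dot u x <= a & F = P `&` plane u a].

Definition vertices P : set 'rV[R]_3 := [set v | face P [set v]].

Definition antipodal P x y : Prop :=
  P x /\ P y /\
  exists u a b, [/\ u != 0, plane u a x, plane u b y &
                    forall z, P z -> b <= dot u z <= a].

Definition midpoint x y : 'rV[R]_3 := 2^-1 *: (x + y).

Lemma dotDr u x y : dot u (x + y) = dot u x + dot u y.
Proof.
by rewrite /dot -big_split; apply: eq_bigr => i _; rewrite mxE mulrDr.
Qed.

Lemma dotZr u a x : dot u (a *: x) = a * dot u x.
Proof.
by rewrite /dot mulr_sumr; apply: eq_bigr => i _; rewrite mxE mulrCA.
Qed.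

Lemma vertices_convex_hull A : vertices (convex_hull A) `<=` A.
Proof.
move=> v [u [a [u0 ua Ev]]]; apply: contrapT => nAv.
have cvxP : convex_set (convex_hull A).
  move=> x y t; rewrite !inE => Px Py B [cB AB].
  by move: (cB x y t); rewrite !inE; apply; [exact: Px | exact: Py].
have /= [Pv uv] : (convex_hull A `&` plane u a) v by rewrite -Ev.
have lt_a x : convex_hull A x -> x <> v -> dot u x < a.
  move=> Px xv; rewrite lt_neqAle ua// andbT; apply/eqP => uxa.
  by apply: xv; have : [set v] x by rewrite Ev.
suff : (convex_hull A `\ v) v by case=> _; apply.
apply: Pv; split=> [|x Ax]; last first.
  by split=> [B [_]|/= xv]; [exact | apply: nAv; rewrite -xv].
apply/convex_setW => x y; rewrite !inE => -[Px xv] [Py yv] t t0 t1.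
apply/mem_set; split; first by move: (cvxP x y t); rewrite !inE; apply.
move=> /= /(congr1 (dot u)); apply/eqP; rewrite uv lt_eqF//.
rewrite /conv/= dotDr !dotZr.
have -> : a = t%:num * a + (1 - t%:num) * a.
  by rewrite -mulrDl addrC subrK mul1r.
by apply: ltrD; rewrite ltr_pM2l ?lt_a// subr_gt0.
Qed.

Lemma finite_vertices P : convex_polyhedron P -> finite_set (vertices P).
Proof.
move=> [[A finA ->] _]; apply: sub_finite_set finA.
exact: vertices_convex_hull.
Qed.

End ConvexGeometry.

Section AntipodalSquareComplex.
Variables (R : realType) (P : set 'rV[R]_3).

(* [fset_set] is the empty set on an infinite set; by [finite_vertices] this
   does not happen for a convex polyhedron. *)
Definition vertex : finType := fset_set (vertices P).

Definition polyhedron_edge (v w : vertex) : Prop :=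
  v != w /\ face P (convex_hull [set val v; val w]).

(* Edges of the antipodal graph, as two-element sets of vertices. *)
Definition antipodal_edge : finType :=
  {e : {set vertex} | `[< exists v w : vertex,
     [/\ v != w, antipodal P (val v) (val w) & e = [set v; w]%SET] >]}.

(* Square cells, as unordered pairs of distinct edges of P. *)
Definition square : finType :=
  {s : {set {set vertex}} | `[< exists v v' w w' : vertex,
     [/\ polyhedron_edge v v', polyhedron_edge w w',
         [set v; v']%SET != [set w; w']%SET,
         antipodal P (midpoint (val v) (val v')) (midpoint (val w) (val w')) &
         s = [set [set v; v']; [set w; w']]%SET] >]}.

(* The edge [e] runs from [(o e).1] to [(o e).2]. *)
Definition edge_orientation (o : antipodal_edge -> vertex * vertex) : Prop :=
  forall e, val e = [set (o e).1; (o e).2]%SET.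

(* [q s = (v, w, v', w')] means that the boundary of the oriented square [s]
   is the closed walk v - w - v' - w' - v. *)
Definition square_orientation
    (q : square -> vertex * vertex * vertex * vertex) : Prop :=
  forall s, let: (v, w, v', w') := q s in
    val s = [set [set v; v']; [set w; w']]%SET.


Variable o : antipodal_edge -> vertex * vertex.

Definition boundary1 (c : {ffun antipodal_edge -> int}) : {ffun vertex -> int} :=
  [ffun v => \sum_e c e * ((v == (o e).2)%:R - (v == (o e).1)%:R)].

Definition cycles1 : set {ffun antipodal_edge -> int} :=
  [set c | boundary1 c = 0].

(* The edge joining [v] and [w], traversed from [v] to [w], as a 1-chain. *)
Definition step (v w : vertex) : {ffun antipodal_edge -> int} :=
  [ffun e => (o e == (v, w))%:R - (o e == (w, v))%:R].

Variable q : square -> vertex * vertex * vertex * vertex.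

Definition boundary_square (s : square) : {ffun antipodal_edge -> int} :=
  let: (v, w, v', w') := q s in
  step v w + step w v' + step v' w' + step w' v.

Definition square_lattice : set {ffun antipodal_edge -> int} :=
  [set c | exists n : square -> int, c = \sum_s boundary_square s *~ n s].

Definition parity (c : {ffun antipodal_edge -> int}) : 'Z_2 :=
  (\sum_e c e)%:~R.

Definition parity_kernel : set {ffun antipodal_edge -> int} :=
  [set c | cycles1 c /\ parity c = 0].

End AntipodalSquareComplex.

(* Main.v *)
(* For a direction u <> 0 let F(u) be the set of vertices maximizing u on P;
   v and w are antipodal iff v is in F(u) and w in F(-u) for some u.  Modulo the
   boundaries of squares, let st(v,w) be the class of the step from v to w.  A
   square on the edges vv' of F(u) and ww' of F(-u) says
   st(v,w) - st(v',w) = st(v,w') - st(v',w'), and since the vertices of F(u) are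
   connected by edges of P, this holds for all v, v' in F(u) and w, w' in F(-u).
   Hence for directions near u one can write st(v,w) = h(v) - k(w).  As F is
   upper semicontinuous and the directions maximized at a vertex form a convex
   cone, such potentials can be glued along connected slices, and the simply
   connected space of nonzero directions carries a global one.  Antisymmetry of
   st makes h - k a constant kappa with 2 kappa = 0, so
   st(v,w) = h(v) - h(w) + kappa, and the class of a cycle is its total
   coefficient times kappa, which vanishes when that coefficient is even. *)
From HB Require Import structures.
Require Import Defs.
From mathcomp Require Import all_boot all_order all_algebra.
From mathcomp Require Import finmap.
From mathcomp Require Import all_classical all_reals all_analysis.
From mathcomp Require Import ring lra.

Set Implicit Arguments.
Unset Strict Implicit.
Unset Printing Implicit Defensive.

Import Order.TTheory GRing.Theory Num.Theory.
Import numFieldNormedType.Exports.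

Local Open Scope classical_set_scope.
Local Open Scope ring_scope.

Lemma sum3 (R : nmodType) (f : 'I_3 -> R) : \sum_i f i = f 0 + f 1 + f 2.
Proof.
rewrite !big_ord_recr big_ord0 /= add0r.
by congr (f _ + f _ + f _); exact/val_inj.
Qed.

Lemma ord3_cases (Q : 'I_3 -> Prop) : Q 0 -> Q 1 -> Q 2 -> forall i, Q i.
Proof.
move=> q0 q1 q2 [[|[|[|//]]] i3].
- by rewrite (_ : Ordinal i3 = 0)//; exact/val_inj.
- by rewrite (_ : Ordinal i3 = 1)//; exact/val_inj.
- by rewrite (_ : Ordinal i3 = 2)//; exact/val_inj.
Qed.

(** * Potentials on the space of directions *)

Section Segments.
Variable R : realType.
Implicit Types (x y z u : 'rV[R]_3) (t : R).

Definition seg t x y : 'rV[R]_3 := (1 - t) *: x + t *: y.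

Lemma seg0 x y : seg 0 x y = x.
Proof. by rewrite /seg subr0 scale1r scale0r addr0. Qed.

Lemma seg1 x y : seg 1 x y = y.
Proof. by rewrite /seg subrr scale0r scale1r add0r. Qed.

Lemma segxx t x : seg t x x = x.
Proof. by rewrite /seg -scalerDl subrK scale1r. Qed.

Lemma segN t x y : seg t (- x) (- y) = - seg t x y.
Proof. by rewrite /seg !scalerN opprD. Qed.

Lemma segE t x y i : seg t x y 0 i = (1 - t) * x 0 i + t * y 0 i.
Proof. by rewrite !mxE. Qed.

Lemma seg_continuous x y : continuous (fun t => seg t x y).
Proof.
move=> t; rewrite /seg; apply: cvgD; apply: cvgZr_tmp; last exact: cvg_id.
by apply: cvgB; [exact: cvg_cst|exact: cvg_id].
Qed.

End Segments.

(** * Constancy along segments of directions *)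

Section Continuation.
Variables (R : realType) (V : Type) (F : 'rV[R]_3 -> V -> Prop).
Implicit Types (x y z u : 'rV[R]_3) (t : R) (v w : V).

Hypothesis F_usc : forall u, \forall x \near u, forall v, F x v -> F u v.
Hypothesis F_ex : forall u, u != 0 -> exists v, F u v.

(** The parameters at which the value [f v] occurs form a clopen subset of the unit interval: by
    semicontinuity, whatever [F] contains near [t] it already contains at [t], where [f] takes only
    one value. *)
Lemma segment_constant (T : Type) (f : V -> T) x y :
  (forall t, 0 <= t <= 1 -> seg t x y != 0) ->
  (forall t v w, 0 <= t <= 1 -> F (seg t x y) v -> F (seg t x y) w ->
     f v = f w) ->
  forall v w, F x v -> F y w -> f v = f w.
Proof.
move=> xy0 fF v w Fxv Fyw.
(* An open neighbourhood of [t] on which [F] can only lose elements compared with [t]. *)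
pose N t : set R := [set s | forall v, F (seg s x y) v -> F (seg t x y) v]°.
have Nt t : N t t.
  exact: (@seg_continuous _ x y t _ (F_usc (seg t x y))).
have NF s t v' : N t s -> F (seg s x y) v' -> F (seg t x y) v'.
  by move=> /interior_subset; exact.
have oN t : open (N t) by exact: open_interior.
pose I : set R := [set` `[0%R, 1%R]].
pose B := [set t : R | 0 <= t <= 1 /\ exists2 v', F (seg t x y) v' & f v' = f v].
have BE : B = I.
  (* Openness uses the neighbourhoods of the parameters in [B], closedness those of the parameters
     outside it. *)
  have /connected_intervalP : is_interval I.
    exact: interval_is_interval.
  apply.
  - by exists 0; split; [rewrite lexx ler01|exists v => //; rewrite seg0].
  - exists (\bigcup_(t in B) N t); first by apply: bigcup_open => t _.
    apply/seteqP; split=> s /=.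
      by move=> Bs; split; [rewrite /I/= in_itv/=; case: Bs|exists s].
    rewrite /I/= in_itv/= => -[s01 [t [t01 [v' Fv' fv']] Ns]]; split=> //.
    have [w' Fw'] := F_ex (xy0 _ s01).
    exists w' => //; rewrite -fv'; apply: (fF t) => //.
    exact: NF Ns Fw'.
  - exists (~` \bigcup_(t in I `\` B) N t).
      by apply: open_closedC; apply: bigcup_open => t _.
    apply/seteqP; split=> s /=.
      move=> [s01 [v' Fv' fv']]; split; first by rewrite /I/= in_itv.
      move=> [t [+ nBt] Ns]; rewrite /I/= in_itv/= => t01; apply: nBt; split=> //.
      by exists v' => //; exact: NF Ns Fv'.
    rewrite /I/= in_itv/= => -[s01 ns]; apply: contrapT => nBs.
    by apply: ns; exists s => //; split=> //; rewrite /I/= in_itv.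
have : B 1 by rewrite BE /I/= in_itv/= ler01 lexx.
move=> [_ [v' Fv' <-]]; apply: (fF 1) => //; last by rewrite seg1.
by rewrite ler01 lexx.
Qed.

End Continuation.

(** * Gluing local potentials *)

Section Potential.
Variables (R : realType) (V : Type) (M : zmodType).
Variables (F : 'rV[R]_3 -> V -> Prop) (st : V -> V -> M).
Implicit Types (x y z u : 'rV[R]_3) (t : R) (v w : V) (C : set 'rV[R]_3).

Hypothesis F_usc : forall u, \forall x \near u, forall v, F x v -> F u v.
Hypothesis F_ex : forall u, u != 0 -> exists v, F u v.
Hypothesis F_seg : forall t x y v,
  0 <= t <= 1 -> F x v -> F y v -> F (seg t x y) v.
Hypothesis F_scale : forall a u v, 0 < a -> F u v -> F (a *: u) v.
Hypothesis F_pointed : forall u v, F u v -> F (- u) v -> u = 0.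
Hypothesis st_rect : forall u v v' w w', u != 0 ->
  F u v -> F u v' -> F (- u) w -> F (- u) w' ->
  st v w - st v' w = st v w' - st v' w'.

(* In the application [F u v] says that the vertex [v] maximizes [u], so that
   [F (- u) w] says that [w] minimizes it. *)
Definition potential C := exists h k : V -> M, forall u v w,
  C u -> u != 0 -> F u v -> F (- u) w -> st v w = h v - k w.

Lemma potentialS C C' : C `<=` C' -> potential C' -> potential C.
Proof.
by move=> CC' [h [k hk]]; exists h, k => u v w /CC'; exact: hk.
Qed.

(** Everything seen from [C] and its antipodes lies in [F u] and [F (- u)], so [st_rect] at the
    single direction [u] separates the two variables around base points [v0] and [w0]. *)
Lemma potential_local u C : u != 0 ->
  (forall x v, C x -> F x v -> F u v) ->
  (forall x v, C x -> F (- x) v -> F (- u) v) -> potential C.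
Proof.
move=> u0 FC FCN; have [v0 Fv0] := F_ex u0.
have [w0 Fw0] : exists w, F (- u) w by apply: F_ex; rewrite oppr_eq0.
exists (fun v => st v w0), (fun w => st v0 w0 - st v0 w) => x v w Cx x0 Fv Fw.
have := st_rect u0 (FC _ _ Cx Fv) Fv0 (FCN _ _ Cx Fw) Fw0.
by move=> /(canRL (subrK _)) ->; rewrite opprB addrA addrAC.
Qed.

(** If the segment met the origin, [- x] would be a positive multiple of [y], and [v] would lie in
    both [F x] and [F (- x)]. *)
Lemma segment_neq0 v x y t : x != 0 -> y != 0 -> F x v -> F y v ->
  0 <= t <= 1 -> seg t x y != 0.
Proof.
move=> x0 y0 Fx Fy /andP[t0 t1]; apply/eqP => s0.
have [t1'|t1'] := eqVneq t 1; first by move: y0; rewrite -s0 t1' seg1 eqxx.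
have t1p : 0 < 1 - t by rewrite subr_gt0 lt_neqAle t1' t1.
have [t0'|t0'] := eqVneq t 0; first by move: x0; rewrite -s0 t0' seg0 eqxx.
have tp : 0 < t by rewrite lt_neqAle eq_sym t0' t0.
have : F (- x) v.
  have -> : - x = (t / (1 - t)) *: y.
    move/eqP: s0; rewrite /seg addr_eq0 => /eqP /(congr1 (fun z => - (1 - t)^-1 *: z)).
    rewrite scalerA mulNr mulVf ?gt_eqF// scaleN1r => ->.
    by rewrite scalerN scaleNr opprK scalerA mulrC.
  by apply: F_scale Fy; rewrite divr_gt0.
by move=> /(F_pointed Fx) xE; rewrite xE eqxx in x0.
Qed.

Lemma ivt_seg (a b c : R) : a <= c <= b ->
  exists2 t, 0 <= t <= 1 & (1 - t) * a + t * b = c.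
Proof.
move=> /andP[ac cb]; have [ab|ab] := eqVneq a b.
  by exists 0; [rewrite lexx ler01|lra].
have ba : 0 < b - a by rewrite subr_gt0 lt_neqAle ab (le_trans ac cb).
exists ((c - a) / (b - a)).
  rewrite ler_pdivrMr// mul1r lerD2r cb andbT.
  by apply: divr_ge0; rewrite subr_ge0 // -subr_ge0 ltW.
by field; rewrite gt_eqF.
Qed.

(* On the slice [x 0 i = c] the two potentials differ by a locally constant, hence
   constant, amount; convexity of the cones makes every vertex seen from both
   sides visible from the slice. *)
Lemma potential_glue C i c :
  (forall x y t, C x -> C y -> 0 <= t <= 1 -> C (seg t x y)) ->
  (forall x y, C x -> C y -> x 0 i = c -> y 0 i = c -> x != 0 -> y != 0 ->
    exists z, [/\ C z, z 0 i = c,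
      forall t, 0 <= t <= 1 -> seg t x z != 0 &
      forall t, 0 <= t <= 1 -> seg t z y != 0]) ->
  potential (C `&` [set x | x 0 i <= c]) ->
  potential (C `&` [set x | c <= x 0 i]) -> potential C.
Proof.
move=> cvxC detC [hA [kA A]] [hB [kB B]].
pose S x := [/\ C x, x 0 i = c & x != 0].
have fg x v w : S x -> F x v -> F (- x) w -> hA v - hB v = kA w - kB w.
  move=> [Cx xc x0] Fv Fw.
  have a := A x v w (conj Cx _) x0 Fv Fw.
  have b := B x v w (conj Cx _) x0 Fv Fw.
  have /eqP : hA v - kA w = hB v - kB w by rewrite -a ?b//= xc.
  by rewrite subr_eq => /eqP ->; rewrite addrAC (addrAC (hB v)) subrr add0r addrC.
have ff x v w : S x -> F x v -> F x w -> hA v - hB v = hA w - hB w.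
  move=> Sx Fv Fw; have [w' Fw'] : exists w, F (- x) w.
    by apply: F_ex; rewrite oppr_eq0; case: Sx.
  by rewrite (fg _ _ _ Sx Fv Fw') (fg _ _ _ Sx Fw Fw').
have fseg x y v w : S x -> S y -> (forall t, 0 <= t <= 1 -> seg t x y != 0) ->
    F x v -> F y w -> hA v - hB v = hA w - hB w.
  move=> [Cx xc _] [Cy yc _] xy0; move: v w.
  apply: (segment_constant F_usc F_ex xy0) => t v w t01; apply: ff.
  by split; [exact: cvxC|rewrite segE xc yc -mulrDl subrK mul1r|exact: xy0].
(* The discrepancy at one point of the slice is carried to any other through the detour point [z];
   on an empty slice 0 serves. *)
have [d fd] : exists d, forall x v, S x -> F x v -> hA v - hB v = d.
  have [[x [v [Sx Fv]]]|nS] := pselect (exists x v, S x /\ F x v); last first.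
    by exists 0 => x v Sx Fv; case: nS; exists x, v.
  exists (hA v - hB v) => y w Sy Fw.
  have [Cx xc x0] := Sx; have [Cy yc y0] := Sy.
  have [z [Cz zc xz zy]] := detC _ _ Cx Cy xc yc x0 y0.
  have z0 : z != 0 by rewrite -(seg1 x z) xz// ler01 lexx.
  have [v' Fv'] := F_ex z0; have Sz : S z by [].
  by rewrite (fseg x z v v')// (fseg z y v' w).
have gd x w : S x -> F (- x) w -> kA w - kB w = d.
  move=> Sx Fw; have [_ _ x0] := Sx; have [v Fv] := F_ex x0.
  by rewrite -(fg _ _ _ Sx Fv Fw) (fd x).
(* The lower half takes precedence and the upper potential is shifted by [d], so only elements seen
   from both halves need an argument. *)
pose h v := if `[< exists x, [/\ C x, x 0 i <= c, x != 0 & F x v] >]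
            then hA v else hB v + d.
pose k w := if `[< exists x, [/\ C x, x 0 i <= c, x != 0 & F (- x) w] >]
            then kA w else kB w + d.
have cross x y : C x -> C y -> x 0 i <= c -> c <= y 0 i ->
    (forall t, 0 <= t <= 1 -> seg t x y != 0) ->
    exists2 t, 0 <= t <= 1 & S (seg t x y).
  move=> Cx Cy xc cy xy0; have /ivt_seg[t t01 tc] : x 0 i <= c <= y 0 i.
    by rewrite xc cy.
  by exists t => //; split; [exact: cvxC|rewrite segE|exact: xy0].
exists h, k => u v w Cu u0 Fv Fw; have [uc|/ltW cu] := leP (u 0 i) c.
  rewrite /h /k !asboolT; [|by exists u..].
  exact: (A u v w).
have hE : h v = hB v + d.
  rewrite /h; case: ifPn => // /asboolP[x [Cx xc x0 Fx]].
  have xu0 t := @segment_neq0 v x u t x0 u0 Fx Fv.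
  have [t t01 St] := cross _ _ Cx Cu xc cu xu0.
  by rewrite -(fd _ v St) 1?addrC ?subrK//; exact: F_seg.
have kE : k w = kB w + d.
  rewrite /k; case: ifPn => // /asboolP[x [Cx xc x0 Fx]].
  have xu0 t : 0 <= t <= 1 -> seg t x u != 0.
    move=> t01; rewrite -oppr_eq0 -segN.
    by apply: (@segment_neq0 w) => //; rewrite oppr_eq0.
  have [t t01 St] := cross _ _ Cx Cu xc cu xu0.
  by rewrite -(gd _ w St) 1?addrC ?subrK// -segN; exact: F_seg.
by rewrite hE kE opprD addrACA subrr addr0; exact: (B u v w).
Qed.

Definition box (a : 'I_3 -> R) (l : 'I_3 -> R) : set 'rV[R]_3 :=
  [set x | forall i, a i <= x 0 i <= a i + l i].

Lemma box_seg a l t x y : box a l x -> box a l y -> 0 <= t <= 1 ->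
  box a l (seg t x y).
Proof.
move=> ax ay /andP[t0 t1] i; rewrite segE.
have /andP[x1 x2] := ax i; have /andP[y1 y2] := ay i.
by apply/andP; split; nra.
Qed.

(** * Bounded convex slices that avoid the origin *)

Section Slice.
Variable T : set 'rV[R]_3.
Hypothesis T_seg : forall t x y, T x -> T y -> 0 <= t <= 1 -> T (seg t x y).
Hypothesis T0 : \forall x \near (0 : 'rV[R]_3), ~ T x.

Let box_potential l := forall a, potential (T `&` box a l).

(** The doubled box is two boxes of the old size glued along their common face. Since [T] is convex
    and misses 0, any two points of the face are joined directly and no real detour is needed. *)
Lemma box_double i l : box_potential l ->
  box_potential (fun j => if j == i then 2 * l j else l j).
Proof.
move=> bl a; have nT0 x : T x -> x != 0.
  by move=> Tx; apply/eqP => x0; apply: (nbhs_singleton T0); rewrite -x0.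
apply: (@potential_glue _ i (a i + l i)).
- move=> x y t [Tx ax] [Ty ay] t01.
  by split; [exact: T_seg|exact: box_seg].
- move=> x y [Tx ax] [Ty ay] xc yc _ _; exists x; split=> // t t01.
    by rewrite segxx nT0.
  by apply/nT0/T_seg.
- apply: potentialS (bl a) => x [[Tx ax] /= xc]; split=> // j.
  by have := ax j; case: eqP => [->|//] /andP[-> _].
- apply: potentialS (bl (fun j => if j == i then a j + l j else a j)).
  move=> x [[Tx ax] /= xc]; split=> // j.
  by have := ax j; case: eqP => [->|//] /andP[_]; rewrite xc; lra.
Qed.

Lemma box_doubles r n : box_potential (fun=> r) ->
  box_potential (fun=> 2 ^+ n * r).
Proof.
move=> br; elim: n => [|n IH]; first by rewrite expr0 mul1r.
move=> a; have b3 := box_double 2 (box_double 1 (box_double 0 IH)).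
apply: potentialS (b3 a) => x [Tx ax]; split=> // j; have := ax j.
have -> : 2 ^+ n.+1 * r = 2 * (2 ^+ n * r) by rewrite exprS mulrA.
by case: j => -[|[|[|//]]] j3.
Qed.

(** At the origin a neighbourhood missing [T] makes the claim vacuous; elsewhere semicontinuity at
    [x] and at [- x] reduces it to [potential_local]. *)
Lemma potential_near x : exists2 N, nbhs x N &
  forall C, C `<=` N -> potential (T `&` C).
Proof.
have [->|x0] := eqVneq x 0.
  exists (~` T) => // C CT; exists (fun=> 0), (fun=> 0) => u v w [Tu Cu].
  by case: (CT u Cu).
exists [set y | (forall v, F y v -> F x v) /\ (forall v, F (- y) v -> F (- x) v)].
  apply: filterI; first exact: F_usc.
  have := F_usc (- x); rewrite /prop_near1 /=; exact: (opp_continuous x).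
by move=> C CN; apply: (potential_local x0) => y v [_ /CN[]] => [+ _|_]; exact.
Qed.

(** A Lebesgue number argument: by compactness of the cube, [T] has a potential on every box of some
    dyadic side, and repeated doubling of the side swallows the cube. *)
Lemma potential_slice : (forall x, T x -> forall i, -1 <= x 0 i <= 1) ->
  potential T.
Proof.
move=> T1; pose K : set 'rV[R]_3 := [set x | forall i, `[-1, 1]%classic (x 0 i)].
have cK : compact K.
  by apply: (@rV_compact R 3 (fun=> `[-1, 1]%classic)) => i; exact: segment_compact.
pose P n x := forall a, box a (fun=> 1 / 2 ^+ n) x ->
  potential (T `&` box a (fun=> 1 / 2 ^+ n)).
have : \forall n \near \oo, K `<=` P n.
  apply: (proj1 (compact_near_coveringP K) cK) => x Kx.
  have [N /nbhs_ballP[e /= e0 eN] NP] := potential_near x.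
  have e2 : 0 < e / 2 by rewrite divr_gt0.
  (* One half of [e] bounds the distance from [x] to [y], the other half the side of a box
     containing [y]. *)
  near=> y n; move=> a ay; apply: NP => z az; apply: eN.
  have n_e : 1 / 2 ^+ n < e / 2.
    by near: n; exact: (near_infty_natSinv_expn_lt (PosNum e2)).
  have xy : ball x (e / 2) y by near: y; exact: nbhsx_ballx.
  rewrite (splitr e); apply: ball_triangle xy _; split=> // i j.
  rewrite ord1 -ball_normE /= ltr_norml.
  have /andP[y1 y2] := ay j; have /andP[z1 z2] := az j.
  by apply/andP; split; lra.
move=> [n _ /(_ n (leqnn n)) KP].
have : box_potential (fun=> 1 / 2 ^+ n).
  move=> a.
  have [[x [Tx ax]]|nT] := pselect (exists x, T x /\ box a (fun=> 1 / 2 ^+ n) x).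
    by apply: KP (ax) => i; rewrite /= in_itv/= T1.
  by exists (fun=> 0), (fun=> 0) => u v w Tu; case: nT; exists u.
(* The cube has side 2, whence one doubling more than [n]; its lower corner is -1 in each
   coordinate. *)
move=> /(box_doubles n.+1)/(_ (fun=> -1)); apply: potentialS => x Tx.
split=> // i; have /andP[-> x1] := T1 x Tx i; rewrite /=.
have -> : 2 ^+ n.+1 * (1 / 2 ^+ n) = 2 :> R by rewrite exprS; field; rewrite expf_neq0.
by move: x1; lra.
Unshelve. all: by end_near. Qed.

End Slice.

(** * From orthants to the space of all directions *)

(** A sign [s i] equal to 0 leaves the coordinate [i] unrestricted, so the same definition covers
    orthants, half-spaces and the whole space. *)
Definition orthant (s : 'I_3 -> R) : set 'rV[R]_3 :=
  [set x | forall i, 0 <= s i * x 0 i].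

Lemma orthant_seg s t x y : orthant s x -> orthant s y -> 0 <= t <= 1 ->
  orthant s (seg t x y).
Proof.
move=> sx sy /andP[t0 t1] i; rewrite segE mulrDr !(mulrCA (s i)).
by rewrite addr_ge0// mulr_ge0 ?subr_ge0.
Qed.

(** The slice [T] is a facet of the octahedron: it is convex, bounded, away from 0, and meets every
    ray of the orthant. *)
Lemma potential_orthant s : (forall i, s i = 1 \/ s i = -1) ->
  potential (orthant s).
Proof.
move=> s1; pose T := orthant s `&` [set x | \sum_i s i * x 0 i = 1].
have [||x [sx]|h [k hk]] := @potential_slice T.
- move=> t x y [sx x1] [sy y1] t01; split; first exact: orthant_seg.
  rewrite /= (eq_bigr (fun i => (1 - t) * (s i * x 0 i) + t * (s i * y 0 i))).
    by rewrite big_split/= -!mulr_sumr x1 y1 !mulr1 subrK.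
  by move=> i _; rewrite segE; ring.
(* Within distance 1/4 of the origin the three summands total less than 3/4, hence not 1. *)
- apply/nbhs_ballP; exists 4^-1 => //= x -[_ x4] [_ /=]; rewrite sum3 => x1.
  have {}x4 i : - 4^-1 < x 0 i < 4^-1.
    by have := x4 0 i; rewrite -ball_normE/= mxE sub0r normrN ltr_norml.
  have xs i : s i * x 0 i < 4^-1.
    by have := x4 i; have [->|->] := s1 i; lra.
  by have := xs 0; have := xs 1; have := xs 2; lra.
- rewrite /= sum3 => x1.
  have xs i : 0 <= s i * x 0 i <= 1.
    rewrite sx /=; move: x1 (sx 0) (sx 1) (sx 2).
    by elim/ord3_cases: i; lra.
  by move=> i; have := xs i; have [->|->] := s1 i; lra.
exists h, k => u v w su u0 Fv Fw; pose m := \sum_i s i * u 0 i.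
have m0 : 0 < m.
  rewrite lt_neqAle sumr_ge0// andbT eq_sym; apply: contraNneq u0 => m0.
  apply/eqP/rowP => i; rewrite mxE; have : s i * u 0 i == 0.
    have : \sum_i s i * u 0 i == 0 by exact/eqP.
    by rewrite psumr_eq0// => /allP/(_ i); rewrite mem_index_enum; exact.
  by rewrite mulf_eq0; have [->|->] := s1 i; rewrite ?oppr_eq0 oner_eq0 => /eqP.
(* Positive rescaling moves [u] onto the slice and keeps [v] and [w] visible. *)
apply: (hk (m^-1 *: u)).
- split=> [i|/=].
    by rewrite mxE mulrCA mulr_ge0// invr_ge0 ltW.
  under eq_bigr do rewrite mxE mulrCA.
  by rewrite -mulr_sumr mulVf// gt_eqF.
- by rewrite scaler_eq0 negb_or u0 invr_eq0 gt_eqF.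
- by apply: F_scale Fv; rewrite invr_gt0.
- by rewrite -scalerN; apply: F_scale Fw; rewrite invr_gt0.
Qed.

(** If the segment from [x] to [y] hits 0, some coordinate [j] is nonzero at both ends. A nonzero
    [z] with vanishing [j]-th coordinate is then parallel to neither. *)
Lemma detour C x y : (forall j, exists2 z, C z & z 0 j = 0 /\ z != 0) ->
  C x -> C y -> x != 0 -> y != 0 ->
  exists z, [/\ C z, forall t, 0 <= t <= 1 -> seg t x z != 0 &
                forall t, 0 <= t <= 1 -> seg t z y != 0].
Proof.
move=> Cz Cx Cy x0 y0.
have [xy0|] := pselect (forall t, 0 <= t <= 1 -> seg t x y != 0).
  by exists x; split=> // t _; rewrite segxx.
move=> /existsNP[t /not_implyP[t01 /negP]]; rewrite negbK => /eqP s0.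
have [j xj] : exists j, x 0 j != 0 by exact/rV0Pn.
have t0 : t != 0 by apply: contraNneq x0 => t0; rewrite -s0 t0 seg0.
have t1 : t != 1 by apply: contraNneq y0 => t1; rewrite -s0 t1 seg1.
have yj : y 0 j != 0.
  apply: contraNneq xj => yj; move/rowP/(_ j): s0.
  rewrite segE yj mulr0 addr0 mxE => /eqP; rewrite mulf_eq0 subr_eq0 eq_sym.
  by rewrite (negbTE t1).
have [z Cz' [zj z0]] := Cz j; exists z; split=> // r _; apply/eqP => r0.
- move/rowP/(_ j): (r0); rewrite segE zj mulr0 addr0 mxE => /eqP.
  rewrite mulf_eq0 (negbTE xj) orbF subr_eq0 => /eqP r1.
  by move: z0; rewrite -r0 -r1 seg1 eqxx.
- move/rowP/(_ j): (r0); rewrite segE zj mulr0 add0r mxE => /eqP.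
  rewrite mulf_eq0 (negbTE yj) orbF => /eqP r1.
  by move: z0; rewrite -r0 r1 seg0 eqxx.
Qed.

(** The two sides of the plane [x 0 i = 0] are glued along it. Connectedness of the slice without
    its origin is where the dimension enters. *)
Lemma potential_free s i :
  potential (orthant (fun j => if j == i then 1 else s j)) ->
  potential (orthant (fun j => if j == i then -1 else s j)) ->
  potential (orthant (fun j => if j == i then 0 else s j)).
Proof.
move=> s1 sN1; apply: (@potential_glue _ i 0).
- by move=> x y t; exact: orthant_seg.
- move=> x y sx sy xi yi x0 y0.
  have [|||//|//|z [[sz zi] xz zy]] := @detour
    (orthant (fun j => if j == i then 0 else s j) `&` [set x | x 0 i = 0]) x y.
  (* Among three coordinates one differs from both [i] and [j]; its axis, taken with the sign that
     [s] allows, gives the required point. *)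
  + move=> j; have [k kj ki] : exists2 k : 'I_3, k != j & k != i.
      by elim/ord3_cases: i {s1 sN1 sx sy xi yi}; elim/ord3_cases: j;
        (by exists 0) || (by exists 1) || (by exists 2).
    pose c := if s k == 0 then 1 else s k.
    exists (\row_l (if l == k then c else 0)); first split=> [l|/=].
    * rewrite mxE; case: eqP => _; first by rewrite mul0r.
      case: eqP => [->|]; last by rewrite mulr0.
      by rewrite /c; case: eqP => [->|_]; rewrite ?mul0r// -expr2 sqr_ge0.
    * by rewrite mxE eq_sym (negbTE ki).
    * rewrite mxE eq_sym (negbTE kj); split=> //; apply/eqP => /rowP/(_ k).
      rewrite !mxE eqxx /c; case: eqP => // _ /eqP; first by rewrite oner_eq0.
  + by [].
  + by [].
  + by exists z.
- apply: potentialS sN1 => x [sx /= x0] j; have := sx j.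
  by case: eqP => // ->; rewrite mulN1r oppr_ge0.
- apply: potentialS s1 => x [sx /= x0] j; have := sx j.
  by case: eqP => // ->; rewrite mul1r.
Qed.

(** The coordinates are freed one at a time, starting from the orthants; in the induction [n] counts
    the leading coordinates whose sign is already 0. *)
Lemma potential_global : potential setT.
Proof.
suff H (s : 'I_3 -> R) n : (n <= 3)%N -> (forall i, s i = if (i < n)%N then 0 else s i) ->
    (forall i : 'I_3, (n <= i)%N -> s i = 1 \/ s i = -1) -> potential (orthant s).
  have : potential (orthant (fun=> 0)).
    by apply: (H _ 3%N) => // i; rewrite ?if_same// leqNgt ltn_ord.
  by apply: potentialS => x _ i; rewrite mul0r.
elim: n s => [s _ _ s1|n IH s n3 s0 s1].
  by apply: potential_orthant => i; exact: s1.
pose i := Ordinal n3.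
have cs c : c = 1 \/ c = -1 -> potential (orthant (fun j => if j == i then c else s j)).
  move=> c1; apply: IH; first exact: ltnW.
    move=> j; case: eqP => [->|_]; first by rewrite /= ltnn.
    by case: ifP => // jn; rewrite s0 ltnS ltnW.
  move=> j nj; case: eqP => // ji; apply: s1; rewrite ltn_neqAle nj andbT.
  by apply/eqP => nj'; apply: ji; exact/val_inj.
apply: potentialS (potential_free (cs 1 _) (cs (-1) _)); [|by left|by right].
move=> x sx j; case: eqP => [_|_]; last exact: sx.
by rewrite mul0r.
Qed.

(** Exchanging [v] and [w] while replacing [u] by [- u] shows that [h - k] changes sign between
    opposite elements. It is therefore constant on each [F u], hence along segments, hence
    everywhere, and equals its own opposite. *)
Lemma potential_antisymmetric : (forall v w, st w v = - st v w) ->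
  exists h : V -> M, exists2 k : M, k + k = 0 &
    forall u v w, u != 0 -> F u v -> F (- u) w -> st v w = h v - h w + k.
Proof.
move=> st_anti; have [h [k hk]] := potential_global.
pose f v := h v - k v.
have fN u v w : u != 0 -> F u v -> F (- u) w -> f v = - f w.
  move=> u0 Fv Fw; have Nu0 : - u != 0 by rewrite oppr_eq0.
  have := hk (- u) w v I Nu0 Fw; rewrite opprK => /(_ Fv).
  rewrite st_anti (hk u v w I u0 Fv Fw) opprB => /eqP.
  rewrite subr_eq => /eqP E.
  by rewrite /f opprB E addrAC (addrAC (h w)) subrr add0r addrC.
have ff u v w : u != 0 -> F u v -> F u w -> f v = f w.
  move=> u0 Fv Fw; have [w' Fw'] : exists w, F (- u) w.
    by apply: F_ex; rewrite oppr_eq0.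
  by rewrite (fN _ _ _ u0 Fv Fw') (fN _ _ _ u0 Fw Fw').
have fseg x y v w : (forall t, 0 <= t <= 1 -> seg t x y != 0) ->
    F x v -> F y w -> f v = f w.
  move=> xy0; move: v w; apply: (segment_constant F_usc F_ex xy0) => t v w t01.
  exact/ff/xy0.
have fconst x y v w : x != 0 -> y != 0 -> F x v -> F y w -> f v = f w.
  move=> x0 y0 Fv Fw; have [|z [_ xz zy]] := @detour setT x y _ I I x0 y0.
    move=> j; exists (delta_mx 0 (if j == 0 then 1 else 0)) => //.
    split; first by rewrite mxE; elim/ord3_cases: j.
    apply/eqP => /rowP/(_ (if j == 0 then 1 else 0)).
    by rewrite !mxE !eqxx => /eqP; rewrite oner_eq0.
  have z0 : z != 0 by rewrite -(seg1 x z) xz// ler01 lexx.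
  by have [v' Fv'] := F_ex z0; rewrite (fseg x z v v')// (fseg z y v' w).
have u0 : const_mx 1 != 0 :> 'rV[R]_3.
  by apply/eqP => /rowP/(_ 0); rewrite !mxE => /eqP; rewrite oner_eq0.
have [v0 Fv0] := F_ex u0.
have Nu0 : - (const_mx 1 : 'rV[R]_3) != 0 by rewrite oppr_eq0.
have [w0 Fw0] := F_ex Nu0.
exists h, (f v0).
  by rewrite {1}(fN _ _ _ u0 Fv0 Fw0) (fconst _ _ _ _ Nu0 u0 Fw0 Fv0) addNr.
move=> u v w u0' Fv Fw; rewrite (hk u)//.
have Nu0' : - u != 0 by rewrite oppr_eq0.
by rewrite (fconst _ _ _ _ u0 Nu0' Fv0 Fw) /f addrA subrK.
Qed.

End Potential.
(** * Faces of a polytope *)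

Section DotCross.
Variable R : realType.
Implicit Types (u x y z d : 'rV[R]_3).

Lemma dotE u x : dot u x = u 0 0 * x 0 0 + u 0 1 * x 0 1 + u 0 2 * x 0 2.
Proof. by rewrite /dot sum3. Qed.

Lemma dotC u x : dot u x = dot x u.
Proof. by rewrite !dotE; ring. Qed.

Lemma dotDl u x y : dot (x + y) u = dot x u + dot y u.
Proof. by rewrite dotC dotDr !(dotC u). Qed.

Lemma dotZl u a x : dot (a *: x) u = a * dot x u.
Proof. by rewrite dotC dotZr (dotC u). Qed.

Lemma dotNl u x : dot (- x) u = - dot x u.
Proof. by rewrite -scaleN1r dotZl mulN1r. Qed.

Lemma dotNr u x : dot u (- x) = - dot u x.
Proof. by rewrite dotC dotNl dotC. Qed.

Lemma dotBr u x y : dot u (x - y) = dot u x - dot u y.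
Proof. by rewrite dotDr dotNr. Qed.

Lemma dot0l x : dot 0 x = 0.
Proof. by rewrite -(scale0r x) dotZl mul0r. Qed.

Lemma dot_segr u t x y : dot u (seg t x y) = (1 - t) * dot u x + t * dot u y.
Proof. by rewrite dotDr !dotZr. Qed.

Lemma dot_segl u t x y : dot (seg t x y) u = (1 - t) * dot x u + t * dot y u.
Proof. by rewrite dotDl !dotZl. Qed.

Lemma dotxx_eq0 x : dot x x <= 0 -> x = 0.
Proof.
rewrite dotE -!expr2 => x0.
have := sqr_ge0 (x 0 0); have := sqr_ge0 (x 0 1); have := sqr_ge0 (x 0 2) => a b c.
apply/rowP => i; rewrite mxE; apply/eqP; rewrite -sqrf_eq0 eq_le sqr_ge0 andbT.
by elim/ord3_cases: i; lra.
Qed.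

Lemma dotxx_gt0 x : x != 0 -> 0 < dot x x.
Proof. by rewrite ltNge; apply: contraNN => /dotxx_eq0 ->. Qed.

Lemma dot_continuous d : continuous (fun x => dot x d).
Proof.
have c i : continuous (fun x : 'rV[R]_3 => x 0 i * d 0 i).
  move=> x; have ci : (fun x : 'rV[R]_3 => x 0 i) @ x --> x 0 i.
  exact: coord_continuous.
exact: (cvgM ci (cvg_cst (d 0 i))).
have -> : (fun x => dot x d) =
    (fun x => x 0 0 * d 0 0) \+ (fun x => x 0 1 * d 0 1) \+ (fun x => x 0 2 * d 0 2).
  by apply/funext => x; rewrite dotE.
by move=> x; exact: (cvgD (cvgD (c 0 x) (c 1 x)) (c 2 x)).
Qed.

(** Addition in ['I_3] is modulo 3, which gives the cyclic formula. *)
Definition cross u x : 'rV[R]_3 := \row_i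
  (u 0 (i + 1) * x 0 (i + 2) - u 0 (i + 2) * x 0 (i + 1)).

Lemma crossE u x : [/\ cross u x 0 0 = u 0 1 * x 0 2 - u 0 2 * x 0 1,
  cross u x 0 1 = u 0 2 * x 0 0 - u 0 0 * x 0 2 &
  cross u x 0 2 = u 0 0 * x 0 1 - u 0 1 * x 0 0].
Proof.
by split; rewrite mxE; congr (u 0 _ * x 0 _ - u 0 _ * x 0 _); exact/val_inj.
Qed.

Lemma dot_crossl u x : dot (cross u x) u = 0.
Proof. by rewrite dotE; have [-> -> ->] := crossE u x; ring. Qed.

Lemma dot_crossr u x : dot (cross u x) x = 0.
Proof. by rewrite dotE; have [-> -> ->] := crossE u x; ring. Qed.

Lemma cross_crossr u x y :
  cross u (cross x y) = dot u y *: x - dot u x *: y.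
Proof.
have [a0 a1 a2] := crossE u (cross x y); have [b0 b1 b2] := crossE x y.
apply/rowP => i; rewrite !dotE; elim/ord3_cases: i.
- by rewrite a0 b1 b2 !mxE; ring.
- by rewrite a1 b0 b2 !mxE; ring.
- by rewrite a2 b0 b1 !mxE; ring.
Qed.

(** Expanding the triple product of [u], [u] and [x] solves for [x]. *)
Lemma cross_eq0 u x : u != 0 -> cross u x = 0 -> exists a, x = a *: u.
Proof.
move=> u0 ux; have uu := dotxx_gt0 u0; exists (dot u x / dot u u).
have := cross_crossr u u x; rewrite ux.
have -> : cross u 0 = 0 by apply/rowP => i; rewrite !mxE; ring.
move/eqP; rewrite eq_sym subr_eq0 => /eqP E.
by rewrite mulrC -scalerA E scalerA mulVf ?scale1r// gt_eqF.
Qed.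

Lemma orthogonal_pair u x d : dot u d = 0 -> dot x d = 0 ->
  cross u x != 0 -> exists a, d = a *: cross u x.
Proof.
move=> ud xd ux; apply: cross_eq0 => //.
have -> : cross (cross u x) d = - cross d (cross u x).
  by apply/rowP => i; rewrite [LHS]mxE [RHS]mxE [in RHS]mxE; ring.
by rewrite cross_crossr dotC xd (dotC d) ud !scale0r subrr oppr0.
Qed.

End DotCross.

(** * Convex hulls *)

Section Hull.
Variable R : realType.
Implicit Types (A B : set 'rV[R]_3) (u x y z : 'rV[R]_3) (t a : R).

Lemma convex_hull_seg A t x y : convex_hull A x -> convex_hull A y ->
  0 <= t <= 1 -> convex_hull A (seg t x y).
Proof.
move=> Ax Ay /andP[t0 t1] B [cB AB].
have t0' : 0 <= 1 - t by rewrite subr_ge0.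
have t1' : 1 - t <= 1 by rewrite gerBl.
have := cB x y (Itv01 t0' t1'); rewrite !inE.
rewrite /seg -[X in _ + X *: y](subKr 1); apply; [exact: Ax|exact: Ay].
Qed.

Lemma sub_convex_hull A : A `<=` convex_hull A.
Proof. by move=> x Ax B [_]; exact. Qed.

(** Closure is tested at interior parameters only, so that strict inequalities at one end survive in
    [maximizer_hull]. *)
Lemma convex_hull_min A B : A `<=` B ->
  (forall t x y, 0 < t < 1 -> B x -> B y -> B (seg t x y)) ->
  convex_hull A `<=` B.
Proof.
move=> AB cB x; apply; split=> //; apply/convex_setW => y z.
rewrite !inE => By Bz k k0 k1.
apply/mem_set; have := cB (1 - k%:num) y z; rewrite /seg subKr; apply=> //.
by rewrite subr_gt0 k1/= gtrBl.
Qed.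

Lemma convex_hull_le A u a : (forall x, A x -> dot u x <= a) ->
  forall x, convex_hull A x -> dot u x <= a.
Proof.
move=> Aa; apply: (@convex_hull_min A [set x | dot u x <= a]) => // t x y.
move=> /andP[t0 t1] /= xa ya.
by rewrite dot_segr; nra.
Qed.

End Hull.

Lemma seq_argmax (R : realType) (T : eqType) (f : T -> R) (l : seq T) :
  l != [::] -> exists2 a, a \in l & forall b, b \in l -> f b <= f a.
Proof.
elim: l => // a l IH _; have [->|l0] := eqVneq l [::].
  by exists a; rewrite ?mem_head// => b; rewrite inE => /eqP ->.
have [b bl bm] := IH l0; have [ab|ba] := leP (f a) (f b).
  exists b; first by rewrite inE bl orbT.
  by move=> c; rewrite inE => /predU1P[->|/bm].
exists a; first exact: mem_head.
by move=> c; rewrite inE => /predU1P[->//|/bm/le_trans]; apply; exact: ltW.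
Qed.

Lemma nbhs_ray (R : realType) (x u : 'rV[R]_3) (N : set 'rV[R]_3) :
  nbhs x N -> exists2 e, 0 < e & N (x + e *: u).
Proof.
move=> xN; have /= : x + e *: u @[e --> (0 : R)] --> x + 0 *: u.
  by apply: cvgD; [exact: cvg_cst|apply: cvgZr_tmp; exact: cvg_id].
rewrite scale0r addr0 => /(_ _ xN)/nbhs_ballP[e /= e0 eN].
have e2 : 0 < e / 2 by rewrite divr_gt0.
exists (e / 2) => //; apply: (eN (e / 2)).
by rewrite /ball/= sub0r normrN gtr0_norm// ltr_pdivrMr// ltr_pMr// ltr1n.
Qed.

(** * Faces on which a direction is maximal *)

Section Polytope.
Variables (R : realType) (s : seq 'rV[R]_3).
Implicit Types (u x y z g a b : 'rV[R]_3) (t : R).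

Let P : set 'rV[R]_3 := convex_hull [set` s].
Hypothesis intP : P° !=set0.

Let sP a : a \in s -> P a. Proof. by move=> ?; exact: sub_convex_hull. Qed.

Definition maximizer u z := P z /\ forall y, P y -> dot u y <= dot u z.

(** Only generators from [s] are kept: a finite set, which still spans the whole face by
    [maximizer_hull]. *)
Definition top u := [set a | a \in s /\ maximizer u a].

(** A small step from an interior point along [u] itself changes the value by a positive multiple of
    [dot u u]. *)
Lemma constant_dot u : (forall y z, P y -> P z -> dot u y = dot u z) -> u = 0.
Proof.
move=> uc; have [z0 z0P] := intP.
have [e e0 Pe] := nbhs_ray u z0P; apply: dotxx_eq0.
have := uc _ _ Pe (interior_subset z0P); rewrite dotDr dotZr => /eqP.
by rewrite -subr_eq0 addrAC subrr add0r mulf_eq0 gt_eqF//= => /eqP ->.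
Qed.

Lemma maximizer_pointed u z : maximizer u z -> maximizer (- u) z -> u = 0.
Proof.
move=> [Pz uz] [_ Nuz]; have E y : P y -> dot u y = dot u z.
  move=> Py; apply/eqP; rewrite eq_le uz//=.
  by have := Nuz y Py; rewrite !dotNl lerN2.
by apply: constant_dot => y z' Py Pz'; rewrite !E.
Qed.

Lemma maximizer_dot u y z : maximizer u y -> maximizer u z -> dot u y = dot u z.
Proof. by move=> [Py uy] [Pz uz]; apply/eqP; rewrite eq_le uy// uz. Qed.

Lemma maximizer_seg t x y z : 0 <= t <= 1 -> maximizer x z -> maximizer y z ->
  maximizer (seg t x y) z.
Proof.
move=> /andP[t0 t1] [Pz xz] [_ yz]; split=> // z' Pz'.
rewrite !dot_segl lerD// ler_wpM2l ?subr_ge0 ?xz ?yz//.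
Qed.

Lemma maximizerZ (c : R) u z : 0 < c -> maximizer u z -> maximizer (c *: u) z.
Proof. by move=> c0 [Pz uz]; split=> // y /uz; rewrite !dotZl ler_pM2l. Qed.

(** A generator that is not maximal at [u] is strictly beaten by some point of [P], and stays beaten
    for nearby directions; there are finitely many generators. *)
Lemma top_near u : \forall x \near u, top x `<=` top u.
Proof.
have near_all (l : seq 'rV[R]_3) (Q : 'rV[R]_3 -> 'rV[R]_3 -> Prop) :
    (forall a, a \in l -> \forall x \near u, Q a x) ->
    \forall x \near u, forall a, a \in l -> Q a x.
  elim: l => [_|a l IH lQ]; first by apply: (@filterE _ (nbhs u)) => x a; rewrite in_nil.
  have := IH (fun b bl => lQ b (mem_behead (s := a :: l) bl)).
  have := lQ a (mem_head _ _); apply: filterS2 => x Qa Ql b.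
  by rewrite inE => /predU1P[->|/Ql].
apply: filterS (near_all s (fun a x => top x a -> top u a) _).
  by move=> x xs a [sa xa]; exact: xs.
move=> a sa; have [ua|nua] := pselect (top u a).
  by apply: (@filterE _ (nbhs u)) => x _.
have [y [Py uy]] : exists y, P y /\ dot u a < dot u y.
  apply: contrapT => ny; apply: nua; split=> //; split; first exact: sP.
  move=> y Py; rewrite leNgt; apply/negP => uy; apply: ny; by exists y.
have : \forall x \near u, 0 < dot x (y - a).
  have cd := cvgr_gt _ (@dot_continuous _ (y - a) u); apply: cd.
  by rewrite dotBr subr_gt0.
apply: filterS => x; rewrite dotBr subr_gt0 => xy [_ [_ /(_ y Py)]].
by rewrite leNgt xy.
Qed.

(** The points strictly below the maximal level, together with those of [B] on it, form a convex set
    containing all generators. *)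
Lemma maximizer_hull u z B : top u `<=` B ->
  (forall t x y, 0 < t < 1 -> B x -> B y -> B (seg t x y)) ->
  maximizer u z -> B z.
Proof.
move=> uB cB [Pz uz].
suff : [set y | dot u y < dot u z \/ B y /\ dot u y = dot u z] z.
  by move=> /= [|[]//]; rewrite ltxx.
apply: (convex_hull_min _ _ Pz) => [a sa|t x y t01 /= xz yz] /=.
  have [auz|zua] := ltP (dot u a) (dot u z); [by left|right].
  have E : dot u a = dot u z by apply/eqP; rewrite eq_le zua uz//; exact: sP.
  by split=> //; apply: uB; split=> //; split; [exact: sP|rewrite E].
have {}xz : dot u x < dot u z \/ B x /\ dot u x = dot u z by [].
rewrite dot_segr; move: t01 (t01) => /andP[t0 t1] t01.
case: xz yz => [xz|[Bx ->]] [yz|[By ->]]; [left; nra|left; nra|left; nra|right].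
by split; [exact: cB|rewrite -mulrDl subrK mul1r].
Qed.

Lemma top_ex u : exists a, top u a.
Proof.
have s0 : s != [::].
  apply/negP => /eqP s0; have [z /interior_subset Pz] := intP.
  apply: (Pz set0); split; first by move=> x y t; rewrite inE.
  by move=> y /=; rewrite s0.
have [a sa am] := seq_argmax (dot u) s0.
exists a; split=> //; split; first exact: sP.
exact: convex_hull_le.
Qed.

(** The face maximizing [g] reduces to [a] by [maximizer_hull]. The direction is nonzero because
    [P], having interior, is not a single point. *)
Lemma top_unique_vertex g a : top g `<=` [set a] -> vertices P a.
Proof.
move=> ga; have Pga z : maximizer g z -> z = a.
  by apply: (maximizer_hull ga) => t x y _ /= -> ->; exact: segxx.
have [b gb] := top_ex g; have {}gb : maximizer g a by rewrite -(ga _ gb); case: gb.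
have g0 : g != 0.
  apply/eqP => g0; have Pa z : P z -> z = a.
    by move=> Pz; apply: Pga; split=> // y _; rewrite g0 !dot0l.
  have /rowP/(_ 0) : (const_mx 1 : 'rV[R]_3) = 0.
    by apply: constant_dot => y z /Pa -> /Pa ->.
  by rewrite !mxE => /eqP; rewrite oner_eq0.
exists g, (dot g a); split=> //; first by case: gb.
apply/seteqP; split=> [_ ->|z [Pz gz]]; first by split=> //; case: gb.
by apply: Pga; split=> // y Py; rewrite gz; case: gb => _; exact.
Qed.

Lemma maximizer_vertex u : exists2 v, vertices P v & maximizer u v.
Proof.
pose l := [seq a <- s | `[< top u a >]].
have lE a : a \in l <-> top u a.
  by rewrite mem_filter; split=> [/andP[/asboolP]|ua]//; rewrite asboolT//; case: ua.
have l0 : l != [::].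
  by have [a /lE] := top_ex u; apply: contraTneq => ->.
(* A point of largest norm on a face is an exposed point of that face. *)
have [a /lE ua amax] := seq_argmax (fun a => dot a a) l0.
exists a; last by case: ua.
(* Tilting [u] slightly towards [a] keeps the maximizers inside the face of [u] and selects there
   those with the largest product with [a]. *)
have [e e0 eu] := nbhs_ray a (top_near u).
apply: (@top_unique_vertex (u + e *: a)) => b eb.
have [_ [_ ub]] := eu _ eb; have [Pa ua'] := ua.2; have [_ [Pb /(_ a Pa)]] := eb.
have bb := amax b (proj2 (lE b) (eu _ eb)).
have uab : dot u a = dot u b by apply/eqP; rewrite eq_le ub//= ua'.
rewrite !dotDl !dotZl uab lerD2l ler_pM2l// => ab.
apply/eqP; rewrite -subr_eq0; apply/eqP/dotxx_eq0.
by rewrite dotDl dotNl !dotBr (dotC b a); lra.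
Qed.

Lemma vertex_exposed v : vertices P v ->
  P v /\ exists g, forall z, P z -> z <> v -> dot g z < dot g v.
Proof.
move=> [g [a [_ ga vE]]]; have [Pv /= gv] : (P `&` plane g a) v by rewrite -vE.
split=> //; exists g => z Pz zv; rewrite gv lt_neqAle ga// andbT.
by apply/eqP => gz; apply: zv; have : [set v] z by rewrite vE.
Qed.

Lemma vertex_mem v : vertices P v -> v \in s.
Proof. exact: vertices_convex_hull. Qed.

(** Generators maximal for [x] are maximal for [u] too, so they lie on a line parallel to
    [cross u x]. Vertices being exposed, [a] and [b] must be the ends of what the face occupies on
    it. *)
Lemma segment_face u x a b : (forall y, top x y -> top u y) ->
  cross u x != 0 -> a != b -> vertices P a -> vertices P b ->
  maximizer x a -> maximizer x b -> face P (convex_hull [set a; b]).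
Proof.
move=> xu ux ab va vb xa xb.
have x0 : x != 0.
  apply: contraNneq ux => ->; apply/eqP/rowP => i; rewrite !mxE; ring.
have T y : maximizer x y -> y \in s -> maximizer u y.
  by move=> xy sy; have [] := xu y (conj sy xy).
have ua := T a xa (vertex_mem va); have ub := T b xb (vertex_mem vb).
have O y : y \in s -> maximizer x y -> exists c, y - a = c *: cross u x.
  move=> sy xy; apply: orthogonal_pair => //; rewrite dotBr.
    by rewrite (@maximizer_dot u y a)// ?subrr//; exact: T.
  by rewrite (@maximizer_dot x y a)// subrr.
have [c bc] := O b (vertex_mem vb) xb.
have c0 : c != 0.
  apply: contraNneq ab => c0; move: bc; rewrite c0 scale0r => /eqP.
  by rewrite subr_eq0 eq_sym.
have [Pa [ga aexp]] := vertex_exposed va; have [Pb [gb bexp]] := vertex_exposed vb.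
have xtop : top x `<=` convex_hull [set a; b].
  move=> y [sy xy]; have [d yd] := O y sy xy; pose t := d / c.
  have yE : y = seg t a b.
    have -> : y = a + d *: cross u x by rewrite -yd addrC subrK.
    have -> : b = a + c *: cross u x by rewrite -bc addrC subrK.
    by rewrite /seg scalerDr addrA -scalerDl subrK scale1r scalerA /t divfK.
  have [Py _] := xy; rewrite yE; apply: convex_hull_seg.
  - by apply: sub_convex_hull; left.
  - by apply: sub_convex_hull; right.
  have [ya|ya] := eqVneq y a.
    suff -> : t = 0 by rewrite lexx ler01.
    move: yd; rewrite ya subrr => /esym/eqP; rewrite scaler_eq0 (negbTE ux) orbF.
    by rewrite /t => /eqP ->; rewrite mul0r.
  have [yb|yb] := eqVneq y b.
    suff -> : t = 1 by rewrite lexx ler01.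
    move: yd; rewrite yb bc => /eqP.
    rewrite -subr_eq0 -scalerBl scaler_eq0 (negbTE ux) orbF subr_eq0.
    by rewrite /t => /eqP <-; rewrite divff.
  (* The functional [ga] is strictly largest at [a], which forces [t] to be positive; [gb] bounds it
     by 1. *)
  have := bexp _ Py (elimN eqP yb); have := bexp _ Pa (elimN eqP ab).
  have := aexp _ Py (elimN eqP ya); have := aexp _ Pb (elimN eqP _).
  rewrite eq_sym => /(_ ab); rewrite yE !dot_segr; set p := dot _ _; set q := dot _ _.
  set p' := dot _ _; set q' := dot _ _ => h1 h2 h3 h4.
  by apply/andP; split; nra.
exists x, (dot x a); split=> //; first by case: xa.
apply/seteqP; split=> z.
  move=> zab; split=> /=.
    move: zab; apply: convex_hull_min => [y [->|->]|t y y' /andP[t0 t1] Py Py'] //.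
    by apply: convex_hull_seg; rewrite ?(ltW t0) ?(ltW t1).
  move: zab; apply: (@convex_hull_min _ _ [set z | dot x z = dot x a]).
    by move=> y [->|->] //=; exact: maximizer_dot.
  by move=> t y y' _ /= ya yb; rewrite dot_segr ya yb -mulrDl subrK mul1r.
move=> [Pz xz]; apply: (maximizer_hull xtop).
  by move=> t y y' /andP[t0 t1] ? ?; apply: convex_hull_seg; rewrite ?(ltW t0) ?(ltW t1).
by split=> // y Py; rewrite xz; case: xa => _; exact.
Qed.

End Polytope.
Lemma subr_swap (M : zmodType) (a b c d : M) : a - b = c - d -> a - c = b - d.
Proof.
by move=> /eqP; rewrite subr_eq => /eqP ->; rewrite addrAC (addrAC c) subrr add0r addrC.
Qed.

(** * Connectedness of faces through edges *)

Section EdgeConnectivity.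
Variables (R : realType) (s : seq 'rV[R]_3).
Implicit Types (u x y z : 'rV[R]_3) (t : R).

Let P : set 'rV[R]_3 := convex_hull [set` s].
Hypothesis intP : P° !=set0.

Lemma ball_seg u e x y t : ball u e x -> ball u e y -> 0 <= t <= 1 ->
  ball u e (seg t x y).
Proof.
move=> [e0 ux] [_ uy] /andP[t0 t1]; split=> // i j; move: (ux i j) (uy i j).
rewrite ord1 segE -!ball_normE /= !ltr_norml => /andP[x1 x2] /andP[y1 y2].
by have [t2|t2] := leP t 2^-1; apply/andP; split; nra.
Qed.

Lemma in_vertex_set a :
  a \in (fset_set (vertices P)) = (a \in vertices P).
Proof.
apply: in_fset_set; apply: sub_finite_set (finite_seq s).
exact: vertices_convex_hull.
Qed.

Lemma vertices_hullE (v : vertex P) : vertices P (val v).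
Proof. by have := fsvalP v; rewrite in_vertex_set inE. Qed.

Lemma vertex_hull a : vertices P a -> exists v : vertex P, val v = a.
Proof.
move=> Pa; have sa : a \in fset_set (vertices P) by rewrite in_vertex_set inE.
by exists [` sa]%fset.
Qed.

Definition maxv u (v : vertex P) := maximizer s u (val v).

Lemma maxv_usc u : \forall x \near u, forall v, maxv x v -> maxv u v.
Proof.
apply: filterS (top_near s u) => x xu v xv.
by have [] := xu (val v) (conj (vertex_mem (vertices_hullE v)) xv).
Qed.

Lemma maxv_ex u : u != 0 -> exists v, maxv u v.
Proof.
move=> _; have [a /vertex_hull[v va] ua] := maximizer_vertex intP u.
by exists v; rewrite /maxv va.
Qed.

(** Pairing a multiple of [u] on the segment with [cross u x] forces [t = 0], that is, the end [x],
    which is not parallel to [u]. *)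
Lemma cross_seg u x z t : u != 0 -> cross u x != 0 -> dot (cross u x) z != 0 ->
  cross u (seg t x z) != 0.
Proof.
move=> u0 ux xz; apply/eqP => /(cross_eq0 u0)[a E].
move/(congr1 (dot (cross u x))): (E); rewrite dot_segr dotZr dot_crossl dot_crossr.
rewrite !mulr0 add0r => /eqP; rewrite mulf_eq0 (negbTE xz) orbF => /eqP t0.
move: E ux; rewrite t0 seg0 => ->; apply/negP; rewrite negbK; apply/eqP/rowP => i.
by rewrite !mxE; ring.
Qed.

(** Tilt [u] towards a functional exposing [v]. A nonnegative multiple of [u] would keep [w]
    maximal, and a negative one would make [v] maximal for both [u] and [- u]. *)
Lemma exposing_near u (v w : vertex P) (N : set 'rV[R]_3) : u != 0 -> v != w ->
  maxv u v -> maxv u w -> nbhs u N -> exists x, [/\ N x, maxv x v & cross u x != 0].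
Proof.
move=> u0 vw uv uw uN; have [Pv [g gv]] := vertex_exposed (vertices_hullE v).
have [e e0 Ne] := nbhs_ray g uN; exists (u + e *: g).
have ev z : P z -> z <> val v -> dot (u + e *: g) z < dot (u + e *: g) (val v).
  move=> Pz zv; rewrite !dotDl !dotZl ler_ltD ?ltr_pM2l ?gv//.
  by case: uv => _; exact.
have mv : maxv (u + e *: g) v.
  split=> // z Pz; have [->//|/eqP zv] := eqVneq z (val v).
  exact/ltW/ev.
split=> //; apply/eqP => /(cross_eq0 u0)[a aE].
have nw : ~ maxv (u + e *: g) w.
  move=> [Pw /(_ _ Pv)]; rewrite leNgt ev// => /val_inj wv.
  by rewrite wv eqxx in vw.
have [a0|a0|a0] := ltgtP a 0.
- have : maxv (- u) v.
    have -> : - u = - a^-1 *: (u + e *: g).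
      by rewrite aE scalerA mulNr mulVf ?scaleN1r// lt_eqF.
    by apply: maximizerZ => //; rewrite oppr_gt0 invr_lt0.
  by move=> /(maximizer_pointed intP uv) uE; rewrite uE eqxx in u0.
- by apply: nw; rewrite aE; exact: maximizerZ.
- apply: nw; rewrite aE a0 scale0r; split=> [|y _]; last by rewrite !dot0l.
  by case: uw.
Qed.

(** Near [u], a direction exposing [v] is joined to one exposing [w] by two segments that avoid the
    line through [u]. Off this line [segment_face] shows that any two distinct maximizers span an
    edge, so [f] is constant along the path. *)
Lemma polyhedron_edge_connected u (T : Type) (f : vertex P -> T) : u != 0 ->
  (forall v w, maxv u v -> maxv u w -> polyhedron_edge v w -> f v = f w) ->
  forall v w, maxv u v -> maxv u w -> f v = f w.
Proof.
move=> u0 fe v w uv uw; have [->//|vw] := eqVneq v w.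
have /nbhs_ballP[e /= e0 eu] := top_near s u.
have ue : nbhs u (ball u e) by exact: nbhsx_ballx.
have [x [xe xv ux]] := exposing_near u0 vw uv uw ue.
have [y [ye yw uy]] : exists y, [/\ ball u e y, maxv y w & cross u y != 0].
  by apply: (exposing_near u0 _ uw uv ue); rewrite eq_sym.
(* A direction [d] off both planes [span(u, x)] and [span(u, y)]. *)
have [d xd yd] : exists2 d, dot (cross u x) d != 0 & dot (cross u y) d != 0.
  have xx := dotxx_gt0 ux; have yy := dotxx_gt0 uy.
  have [xy|xy] := eqVneq (dot (cross u y) (cross u x)) 0.
    exists (cross u x + cross u y); rewrite dotDr.
      by rewrite (dotC (cross u x) (cross u y)) xy addr0 gt_eqF.
    by rewrite xy add0r gt_eqF.
  by exists (cross u x) => //; rewrite gt_eqF.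
(* The corner of the path: [u] is orthogonal to both normals, so the products of [z] with them are
   those of [d] scaled by [r]. *)
have [r r0 rz] := nbhs_ray d ue; set z := u + r *: d in rz.
have z0 c : dot (cross u c) d != 0 -> dot (cross u c) z != 0.
  by move=> cd; rewrite dotDr dotZr dot_crossl add0r mulf_neq0// gt_eqF.
have H c c' c'' : ball u e c -> cross u c != 0 -> dot (cross u c) d != 0 ->
    maxv c c' -> maxv z c'' -> f c' = f c''.
  move=> ce uc cd; have ucz t := cross_seg t u0 uc (z0 _ cd).
  move: c' c''; apply: (segment_constant maxv_usc maxv_ex).
    move=> t _; apply: contraNneq (ucz t) => ->.
    by apply/eqP/rowP => i; rewrite !mxE; ring.
  move=> t a b t01 ca cb; have [->//|ab] := eqVneq a b.
  have tu : forall y, top s (seg t c z) y -> top s u y by apply/eu/ball_seg.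
  have up a' : maxv (seg t c z) a' -> maxv u a'.
    by move=> m; have [] := tu (val a') (conj (vertex_mem (vertices_hullE a')) m).
  apply: fe; [exact: up|exact: up|split=> //].
  apply: (segment_face tu) => //; exact: vertices_hullE.
have zn0 : z != 0.
  by apply: contraNneq (z0 _ xd) => ->; rewrite dotC dot0l.
by have [c zc] := maxv_ex zn0; rewrite (H x v c)// (H y w c).
Qed.

(** With one pair fixed, the relation says that a difference of [st] values is constant in the other
    variable. Edge connectivity is applied first on the face of [- u], then on that of [u]. *)
Lemma rectangle_relation (M : zmodType) (st : vertex P -> vertex P -> M) :
  (forall u v v' w w', u != 0 -> maxv u v -> maxv u v' ->
    maxv (- u) w -> maxv (- u) w' -> polyhedron_edge v v' ->
    polyhedron_edge w w' -> st v w - st v' w = st v w' - st v' w') ->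
  forall u v v' w w', u != 0 -> maxv u v -> maxv u v' ->
    maxv (- u) w -> maxv (- u) w' -> st v w - st v' w = st v w' - st v' w'.
Proof.
move=> sq u v v' w w' u0 uv uv' uw uw'; have Nu0 : - u != 0 by rewrite oppr_eq0.
move: w w' uw uw'; apply: (polyhedron_edge_connected Nu0) => w w' uw uw' ww'.
suff E : st v w - st v w' = st v' w - st v' w'.
  exact: subr_swap.
move: v v' uv uv'; apply: (polyhedron_edge_connected u0) => v v' uv uv' vv'.
exact/subr_swap/(sq u).
Qed.

End EdgeConnectivity.
(** * Chains of the antipodal graph *)

(** Membership in a subgroup becomes the vanishing of an additive map, whose target is the group
    where potentials take values. *)
Lemma quotient_zmodule (C : zmodType) (L : set C) : L 0 ->
  (forall x y, L x -> L y -> L (x - y)) ->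
  exists (M : zmodType) (f : {additive C -> M}), forall c, f c = 0 <-> L c.
Proof.
move=> L0 LB; pose S : pred C := fun c => `[< L c >].
have Scl : zmod_closed S.
  split=> [|x y]; first exact/asboolP.
  by move=> /asboolP Lx /asboolP Ly; apply/asboolP; exact: LB.
pose SZ := GRing.isZmodClosed.Build C S Scl.
pose Z : zmodClosed C := HB.pack S SZ.
exists (Quotient.quot Z), (\pi_(Quotient.quot Z))%qT => c.
rewrite -[c in X in X <-> _]subr0; split=> [|Lc].
  move/eqP; rewrite subr0 -(raddf0 (\pi_(Quotient.quot Z))%qT).
  by rewrite -Quotient.idealrBE subr0 => /asboolP.
apply/eqP; rewrite subr0 -(raddf0 (\pi_(Quotient.quot Z))%qT) -Quotient.idealrBE subr0.
exact/asboolP.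
Qed.

Lemma set2_inj (T : finType) (a b c d : T) : [set a; b]%SET = [set c; d]%SET ->
  (a = c /\ b = d) \/ (a = d /\ b = c).
Proof.
move=> E; have := set21 a b; have := set22 a b; rewrite E !inE.
have := set21 c d; have := set22 c d; rewrite -E !inE.
do 4! (move=> /orP[/eqP ?|/eqP ?]); subst; auto.
Qed.

(** * The relation imposed by a square *)

Section Rectangle.
Variables (V : Type) (M : zmodType) (st : V -> V -> M).
Implicit Types v w : V.

(** In this form the relation is insensitive to how the two unordered pairs of a square are listed,
    as the next lemmas show. *)
Definition rectangle v v' w w' := st v w - st v' w = st v w' - st v' w'.

Lemma rectangle_swapl v v' w w' : rectangle v v' w w' -> rectangle v' v w w'.
Proof. by rewrite /rectangle => /(congr1 -%R); rewrite !opprB. Qed.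

Lemma rectangle_swapr v v' w w' : rectangle v v' w w' -> rectangle v v' w' w.
Proof. exact: esym. Qed.

Hypothesis stN : forall v w, st w v = - st v w.

Lemma rectangleC v v' w w' : rectangle v v' w w' -> rectangle w w' v v'.
Proof.
rewrite /rectangle !(stN v) !(stN v') => /subr_swap/(congr1 -%R).
by rewrite !opprD.
Qed.

Lemma rectangle_loop v v' w w' :
  st v w + st w v' + st v' w' + st w' v = 0 -> rectangle v v' w w'.
Proof.
rewrite (stN v' w) (stN v w') => /eqP; rewrite subr_eq add0r => /eqP E.
by rewrite /rectangle -E addrK.
Qed.

End Rectangle.

(** * Cycles, parity and the square lattice *)

Section Chains.
Variables (R : realType) (s : seq 'rV[R]_3).
Let P : set 'rV[R]_3 := convex_hull [set` s].
Hypothesis intP : P° !=set0.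
Variable o : antipodal_edge P -> vertex P * vertex P.
Hypothesis oE : edge_orientation o.
Implicit Types (u : 'rV[R]_3) (v w : vertex P) (e : antipodal_edge P).

Lemma antipodal_maxv v w : antipodal P (val v) (val w) <->
  exists u, [/\ u != 0, maxv u v & maxv (- u) w].
Proof.
split=> [[Pv [Pw [u [a [b [u0 /= va wb uab]]]]]]|[u [u0 [Pv uv] [Pw uw]]]].
  exists u; split=> //; split=> // z /uab/andP[bz za]; first by rewrite va.
  by rewrite !dotNl lerN2 wb.
split=> //; split=> //; exists u, (dot u (val v)), (dot u (val w)); split=> // z Pz.
by rewrite uv// andbT; have := uw _ Pz; rewrite !dotNl lerN2.
Qed.

Lemma antipodal_sym v w : antipodal P (val v) (val w) -> antipodal P (val w) (val v).
Proof.
move=> /antipodal_maxv[u [u0 uv uw]]; apply/antipodal_maxv; exists (- u).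
by rewrite oppr_eq0 opprK.
Qed.

Lemma maxv_neq u v w : u != 0 -> maxv u v -> maxv (- u) w -> v != w.
Proof.
move=> u0 uv uw; apply: contraNneq u0 => vw; apply/eqP.
by apply: (maximizer_pointed intP uv); rewrite vw.
Qed.

(** A mean of two numbers reaches a common bound only if both do, so a direction extremal at a
    midpoint is extremal at both ends. *)
Lemma antipodal_midpoint v v' w w' :
  antipodal P (midpoint (val v) (val v')) (midpoint (val w) (val w')) <->
  exists u, [/\ u != 0, maxv u v, maxv u v', maxv (- u) w & maxv (- u) w'].
Proof.
have inP (x : vertex P) : P (val x).
  by have [] := vertex_exposed (vertices_hullE x).
have mid u (x y : vertex P) : dot u (midpoint (val x) (val y)) =
    (dot u (val x) + dot u (val y)) / 2.
  by rewrite dotZr dotDr mulrC.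
have mean_max (x y a : R) : x <= a -> y <= a -> (x + y) / 2 = a -> x = a /\ y = a.
  by move=> xa ya m; split; lra.
have mean_min (x y b : R) : b <= x -> b <= y -> (x + y) / 2 = b -> x = b /\ y = b.
  by move=> xb yb m; split; lra.
split=> [[_ [_ [u [a [b [u0 /= va wb uab]]]]]]|[u [u0 uv uv' uw uw']]].
  move: va wb; rewrite /plane /= !mid => va wb.
  have ab x := uab _ (inP x).
  have /andP[_ v1] := ab v; have /andP[_ v2] := ab v'.
  have /andP[w1 _] := ab w; have /andP[w2 _] := ab w'.
  have [va1 va2] := mean_max _ _ _ v1 v2 va; have [wb1 wb2] := mean_min _ _ _ w1 w2 wb.
  by exists u; split=> //; (split; [exact: inP|]) => z /uab/andP[bz za];
    rewrite ?dotNl ?lerN2 ?va1 ?va2 ?wb1 ?wb2.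
have midP (x y : vertex P) : P (midpoint (val x) (val y)).
  have -> : midpoint (val x) (val y) = seg 2^-1 (val x) (val y).
    by rewrite /midpoint /seg scalerDr; congr (_ *: _ + _); lra.
  apply: (convex_hull_seg (inP x) (inP y)).
  by rewrite invr_ge0 ler0n invf_le1 ?ler1n.
do 2 (split; first exact: midP).
exists u, (dot u (val v)), (dot u (val w)); rewrite /plane /= !mid.
rewrite -(maximizer_dot uv uv'); have := maximizer_dot uw uw'.
rewrite !dotNl => /oppr_inj <-.
split=> //; [by field|by field|] => z Pz.
by have [_ ->] := uv; rewrite // andbT; have [_ /(_ z Pz)] := uw; rewrite !dotNl lerN2.
Qed.

Lemma edge_ex v w : v != w -> antipodal P (val v) (val w) ->
  exists e, val e = [set v; w]%SET.
Proof.
move=> vw avw.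
have h : `[< exists v' w' : vertex P, [/\ v' != w', antipodal P (val v') (val w') &
    [set v; w]%SET = [set v'; w']%SET] >] by apply/asboolP; exists v, w.
by exists (Sub [set v; w]%SET h); rewrite SubK.
Qed.

Lemma o_neq e : (o e).1 != (o e).2.
Proof.
have /asboolP[v [w [vw _ eE]]] := valP e.
by move: eE; rewrite oE => /set2_inj[[-> ->]|[-> ->]]//; rewrite eq_sym.
Qed.

Lemma o_antipodal e : antipodal P (val (o e).1) (val (o e).2).
Proof.
have /asboolP[v [w [_ vw eE]]] := valP e.
move: eE; rewrite oE => /set2_inj[[-> ->]|[-> ->]]//; exact: antipodal_sym.
Qed.

Lemma stepN v w : step o w v = - step o v w.
Proof. by apply/ffunP => e; rewrite !ffunE opprB. Qed.

Lemma step_oE e : step o (o e).1 (o e).2 = [ffun e' => (e' == e)%:R].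
Proof.
apply/ffunP => e'; rewrite !ffunE.
have -> : (o e' == ((o e).2, (o e).1)) = false.
  apply/eqP => E; have ee : e' = e by apply: val_inj; rewrite !oE E /= finset.setUC.
  by have := o_neq e; rewrite -{1}ee E /= eqxx.
rewrite subr0 -surjective_pairing; congr (_%:R); congr nat_of_bool.
by apply/eqP/eqP => [E|->//]; apply: val_inj; rewrite !oE E.
Qed.

Lemma chain_step (c : {ffun antipodal_edge P -> int}) :
  c = \sum_e step o (o e).1 (o e).2 *~ c e.
Proof.
apply/ffunP => e; rewrite sum_ffunE (bigD1 e)//= big1 ?addr0.
  by rewrite step_oE ffunMzE ffunE eqxx intz.
by move=> e' ee; rewrite step_oE ffunMzE ffunE eq_sym (negbTE ee) mul0rz.
Qed.

Lemma boundary1_is_zmod_morphism : zmod_morphism (boundary1 o).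
Proof.
move=> c d; apply/ffunP => v; rewrite !ffunE -sumrB; apply: eq_bigr => e _.
by rewrite !ffunE mulrBl.
Qed.

HB.instance Definition _ := GRing.isZmodMorphism.Build _ _ (boundary1 o)
  boundary1_is_zmod_morphism.

Lemma parity_is_zmod_morphism : zmod_morphism (@parity R P).
Proof.
move=> c d; rewrite /parity -rmorphB -sumrB; congr (_%:~R).
by apply: eq_bigr => e _; rewrite !ffunE.
Qed.

HB.instance Definition _ := GRing.isZmodMorphism.Build _ _ (@parity R P)
  parity_is_zmod_morphism.

Lemma boundary1BE (c d : {ffun antipodal_edge P -> int}) v :
  boundary1 o (c - d) v = boundary1 o c v - boundary1 o d v.
Proof.
by rewrite !ffunE -sumrB; apply: eq_bigr => e _; rewrite !ffunE mulrBl.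
Qed.

Lemma parityB (c d : {ffun antipodal_edge P -> int}) :
  parity (c - d) = parity c - parity d.
Proof.
rewrite /parity -rmorphB -sumrB; congr (_%:~R).
by apply: eq_bigr => e _; rewrite !ffunE.
Qed.

Lemma boundary1_parity_step v w : v != w -> antipodal P (val v) (val w) ->
  (forall x, boundary1 o (step o v w) x = (x == w)%:R - (x == v)%:R) /\
  parity (step o v w) = 1.
Proof.
have H e : (forall x, boundary1 o (step o (o e).1 (o e).2) x =
      (x == (o e).2)%:R - (x == (o e).1)%:R) /\
    parity (step o (o e).1 (o e).2) = 1.
  rewrite step_oE; split=> [x|].
    rewrite !ffunE (bigD1 e)//= big1 ?addr0.
      by rewrite ffunE eqxx mul1r.
    by move=> e' /negbTE ee; rewrite ffunE ee mul0r.
  rewrite /parity (bigD1 e)//= big1 ?addr0 ?ffunE ?eqxx//.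
  by move=> e' /negbTE ee; rewrite ffunE ee.
move=> vw /(edge_ex vw)[e]; rewrite oE => /set2_inj[[<- <-]//|[<- <-]].
have [B p] := H e; rewrite stepN -sub0r; split=> [x|].
  rewrite boundary1BE B (_ : boundary1 o 0 x = 0) ?sub0r ?opprB//.
  by rewrite ffunE big1// => e' _; rewrite ffunE mul0r.
(* Reversing a step does not affect parity, since -1 and 1 agree modulo 2. *)
rewrite parityB p (_ : parity 0 = 0); first exact/val_inj.
by rewrite /parity big1// => e' _; rewrite ffunE.
Qed.

(** The chains stand for the four sides of a square, all directed from [v] or [v'] to [w] or [w'];
    alternating signs turn them into the closed walk. *)
Lemma alternating_kernel (a b c d : {ffun antipodal_edge P -> int}) v w v' w' :
  (forall x, boundary1 o a x = (x == w)%:R - (x == v)%:R) ->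
  (forall x, boundary1 o b x = (x == w)%:R - (x == v')%:R) ->
  (forall x, boundary1 o c x = (x == w')%:R - (x == v')%:R) ->
  (forall x, boundary1 o d x = (x == w')%:R - (x == v)%:R) ->
  parity a = 1 -> parity b = 1 -> parity c = 1 -> parity d = 1 ->
  parity_kernel o (a - b + c - d).
Proof.
move=> A B C D pa pb pc pd; have -> : a - b + c - d = a - b - (d - c).
  by rewrite opprB addrA addrAC -addrA (addrC (- d)) addrA.
split; last by rewrite !parityB pa pb pc pd !subrr.
apply/ffunP => x; rewrite [RHS]ffunE.
rewrite !boundary1BE A B C D.
by case: (x == v) (x == w) (x == v') (x == w') => [] [] [] [].
Qed.

Variable q : square P -> vertex P * vertex P * vertex P * vertex P.
Hypothesis qE : square_orientation q.

Lemma square_boundary_kernel sq : parity_kernel o (boundary_square o q sq).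
Proof.
have := qE sq; rewrite /boundary_square; case: (q sq) => [[[v w] v'] w'] E.
suff H x y : x \in [set v; v']%SET -> y \in [set w; w']%SET ->
    x != y /\ antipodal P (val x) (val y).
  have [vv vv'] : v \in [set v; v']%SET /\ v' \in [set v; v']%SET by rewrite set21 set22.
  have [ww ww'] : w \in [set w; w']%SET /\ w' \in [set w; w']%SET by rewrite set21 set22.
  have [B1 p1] := boundary1_parity_step (H _ _ vv ww).1 (H _ _ vv ww).2.
  have [B2 p2] := boundary1_parity_step (H _ _ vv' ww).1 (H _ _ vv' ww).2.
  have [B3 p3] := boundary1_parity_step (H _ _ vv' ww').1 (H _ _ vv' ww').2.
  have [B4 p4] := boundary1_parity_step (H _ _ vv ww').1 (H _ _ vv ww').2.
  rewrite (stepN v' w) (stepN v w').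
  exact: (alternating_kernel B1 B2 B3 B4 p1 p2 p3 p4).
have /asboolP[a [a' [b [b' [_ _ _ m sqE]]]]] := valP sq.
have [u [u0 ua ua' ub ub']] := (antipodal_midpoint _ _ _ _).1 m.
have ab c d : c \in [set a; a']%SET -> d \in [set b; b']%SET ->
    c != d /\ antipodal P (val c) (val d).
  move=> ca db; have uc : maxv u c by move: ca; rewrite !inE => /orP[]/eqP ->.
  have ud : maxv (- u) d by move: db; rewrite !inE => /orP[]/eqP ->.
  by split; [exact: maxv_neq uc ud|apply/antipodal_maxv; exists u].
(* The walk chosen by [q] may start with either of the two edges of [P]. *)
move: E; rewrite sqE => /set2_inj[[<- <-]|[<- <-]]; first exact: ab.
move=> xb ya; have [yx yxa] := ab _ _ ya xb.
by rewrite eq_sym; split=> //; exact: antipodal_sym.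
Qed.

Lemma parity_kernel_sum (I : finType) (F : I -> {ffun antipodal_edge P -> int})
    (n : I -> int) : (forall i, parity_kernel o (F i)) ->
  parity_kernel o (\sum_i F i *~ n i).
Proof.
move=> FK; split.
  have bE : boundary1 o (\sum_i F i *~ n i) = \sum_i boundary1 o (F i) *~ n i.
    rewrite (raddf_sum (boundary1 o)); apply: eq_bigr => i _.
    exact: (raddfMz (boundary1 o)).
  rewrite /cycles1 /mkset bE big1// => i _; have [K _] := FK i.
  by rewrite (K : boundary1 o (F i) = 0) mul0rz.
have pE : parity (\sum_i F i *~ n i) = \sum_i parity (F i) *~ n i.
  rewrite (raddf_sum (@parity R P)); apply: eq_bigr => i _.
  exact: (raddfMz (@parity R P)).
by rewrite pE big1// => i _; have [_ ->] := FK i; rewrite mul0rz.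
Qed.

Lemma square_ex u v v' w w' : u != 0 -> maxv u v -> maxv u v' ->
  maxv (- u) w -> maxv (- u) w' -> polyhedron_edge v v' -> polyhedron_edge w w' ->
  exists sq : square P, val sq = [set [set v; v']; [set w; w']]%SET.
Proof.
move=> u0 uv uv' uw uw' vv' ww'.
have h : `[< exists a a' b b' : vertex P,
     [/\ polyhedron_edge a a', polyhedron_edge b b',
         [set a; a']%SET != [set b; b']%SET,
         antipodal P (midpoint (val a) (val a')) (midpoint (val b) (val b')) &
         [set [set v; v']; [set w; w']]%SET = [set [set a; a']; [set b; b']]%SET] >].
  apply/asboolP; exists v, v', w, w'; split=> //.
    apply/eqP => E; have := set21 v v'; rewrite E !inE => /orP[]/eqP vE.
      by have := maxv_neq u0 uv uw; rewrite vE eqxx.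
    by have := maxv_neq u0 uv uw'; rewrite vE eqxx.
  by apply/antipodal_midpoint; exists u.
by exists (Sub [set [set v; v']; [set w; w']]%SET h); rewrite SubK.
Qed.

Lemma square_lattice_boundary sq : square_lattice o q (boundary_square o q sq).
Proof.
exists (fun sq' => (sq' == sq)%:R); rewrite (bigD1 sq)//= eqxx mulr1z big1 ?addr0//.
by move=> sq' /negbTE ->; rewrite mulr0z.
Qed.

Lemma square_latticeB c d : square_lattice o q c -> square_lattice o q d ->
  square_lattice o q (c - d).
Proof.
move=> [n ->] [m ->]; exists (fun sq => n sq - m sq); rewrite -sumrB.
by apply: eq_bigr => sq _; rewrite mulrzBr.
Qed.

Lemma square_lattice0 : square_lattice o q 0.
Proof. by exists (fun=> 0); rewrite big1// => sq _; rewrite mulr0z. Qed.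

Lemma even_Zp2 (n : int) : n%:~R = 0 :> 'Z_2 -> exists m, n = 2 * m.
Proof.
move=> n0; exists (n %/ 2)%Z; rewrite {1}(divz_eq n 2) mulrC.
have /andP[r0 r2] : (0 <= (n %% 2)%Z < 2) by rewrite modz_ge0//= ltz_mod.
have : ((n %% 2)%Z)%:~R = 0 :> 'Z_2.
  move: n0; rewrite {1}(divz_eq n 2) rmorphD rmorphM /=.
  by rewrite (_ : 2%:~R = 0 :> 'Z_2) ?mulr0 ?add0r//; exact/val_inj.
case: (n %% 2)%Z r0 r2 => [[|[|//]]|//] _ _; first by rewrite addr0.
by move=> /(congr1 val).
Qed.

(** In the quotient by the lattice, the potential terms of a cycle cancel at each vertex and the
    constant [k], of order at most 2, is taken an even number of times. *)
Lemma parity_kernel_sub_lattice c : parity_kernel o c -> square_lattice o q c.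
Proof.
move=> [c0 pc]; have [M [f fL]] := quotient_zmodule square_lattice0 square_latticeB.
have [st [stE stN]] : exists st : vertex P -> vertex P -> M,
    (forall v w, f (step o v w) = st v w) /\ (forall v w, st w v = - st v w).
  exists (fun v w => f (step o v w)); split=> // v w.
  by rewrite -(raddfN f) -stepN.
have f4 c1 c2 c3 c4 : f (c1 + c2 + c3 + c4) = f c1 + f c2 + f c3 + f c4.
  by rewrite !(raddfD f).
have sqrect u v v' w w' : u != 0 -> maxv u v -> maxv u v' ->
    maxv (- u) w -> maxv (- u) w' -> polyhedron_edge v v' ->
    polyhedron_edge w w' -> rectangle st v v' w w'.
  move=> u0 uv uv' uw uw' vv' ww'.
  have [sq sqE] := square_ex u0 uv uv' uw uw' vv' ww'.
  have /fL := square_lattice_boundary sq; have := qE sq; rewrite /boundary_square.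
  case: (q sq) => [[[a b] a'] b']; rewrite sqE => E.
  rewrite f4 => ab0.
  have ab : st a b + st b a' + st a' b' + st b' a = 0.
    by rewrite -[RHS]ab0; congr (_ + _ + _ + _); exact/esym/stE.
  have {ab} := rectangle_loop stN ab; move: E.
  (* The labels given by [q] match [v], [v'], [w], [w'] up to the symmetries of [rectangle]. *)
  by move=> /set2_inj[] [/set2_inj[[-> ->]|[-> ->]] /set2_inj[[-> ->]|[-> ->]]];
    auto using rectangleC, rectangle_swapl, rectangle_swapr.
have [h [k kk hk]] := potential_antisymmetric (@maxv_usc R s) (maxv_ex intP)
  (fun t x y v => @maximizer_seg R s t x y (val v))
  (fun a u v => @maximizerZ R s a u (val v))
  (fun u v => @maximizer_pointed R s intP u (val v))
  (rectangle_relation intP sqrect) stN.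
have fsum (F : antipodal_edge P -> {ffun antipodal_edge P -> int}) :
    f (\sum_e F e *~ c e) = \sum_e f (F e) *~ c e.
  by rewrite (raddf_sum f); apply: eq_bigr => e _; rewrite (raddfMz f).
have fc : f c = \sum_e (h (o e).1 - h (o e).2) *~ c e + k *~ (\sum_e c e).
  rewrite {1}(chain_step c) fsum mulrz_sumr -big_split /=; apply: eq_bigr => e _.
  have [u [u0 u1 u2]] := (antipodal_maxv _ _).1 (o_antipodal e).
  by rewrite stE (hk u)// mulrzDl.
apply/fL; rewrite fc.
have [m ->] := even_Zp2 pc; rewrite mulrzA (_ : k *~ 2 = 0) ?mul0rz ?addr0//.
have pick y n : \sum_x h x *~ (n * (x == y)%:R) = h y *~ n.
  rewrite (bigD1 y)//= eqxx mulr1 big1 ?addr0// => x /negbTE ->.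
  by rewrite mulr0 mulr0z.
(* Summation by parts: potential differences along edges become the pairing of [h] with the boundary
   of [c]. *)
have hb : \sum_x h x *~ boundary1 o c x = \sum_e (h (o e).2 - h (o e).1) *~ c e.
  under eq_bigr do rewrite ffunE mulrz_sumr.
  rewrite exchange_big; apply: eq_bigr => e _.
  under eq_bigr do rewrite mulrBr mulrzBr.
  by rewrite sumrB !pick mulrzBl.
rewrite -[LHS]opprK -sumrN.
rewrite (eq_bigr (fun e => (h (o e).2 - h (o e).1) *~ c e)); last first.
  by move=> e _; rewrite -mulNrz opprB.
rewrite -hb big1 ?oppr0// => x _.
by rewrite (c0 : boundary1 o c = 0) ffunE mulr0z.
Qed.

End Chains.

Theorem theorem9p1 (R : realType) (P : set 'rV[R]_3)
    (o : antipodal_edge P -> vertex P * vertex P)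
    (q : square P -> vertex P * vertex P * vertex P * vertex P) :
  convex_polyhedron P -> edge_orientation o -> square_orientation q ->
  square_lattice o q = parity_kernel o.
Proof.
move=> [[A /finite_seqP[s ->] PE] intP] oE qE; subst P.
apply/seteqP; split=> c; last exact: parity_kernel_sub_lattice.
by move=> [n ->]; apply: parity_kernel_sum => sq; exact: square_boundary_kernel.
Qed.
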